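(* If $A\sim\operatorname{Haar}(\operatorname{O}(n))$ or $A\sim\operatorname{Haar}(\operatorname{U}(n))$, then $\Pi(A)\sim n-\Upsilon_n$.
   Context: $X\sim Y$ means equality in distribution. $\operatorname{O}(n)$ and $\operatorname{U}(n)$ are the groups of $n\times n$ real orthogonal and complex unitary matrices; $\operatorname{Haar}(G)$ is the normalized Haar probability measure on a compact group $G$. $\mathbb F$ is $\mathbb R$ or $\mathbb C$. Gaussian elimination with partial pivoting (GEPP): for an $n\times n$ matrix $A$ over $\mathbb F$, put $A^{(1)}=A$. At step $k=1,\dots,n-1$, choose $i_k\in\{k,\dots,n\}$ with $|A^{(k)}_{i_k k}| = \max_{k\le i\le n}|A^{(k)}_{ik}|$, taking $i_k=k$ if $|A^{(k)}_{kk}|$ is already maximal; interchange rows $k$ and $i_k$ of $A^{(k)}$ (no change if $i_k=k$); then eliminate the entries below the diagonal in column $k$ by subtracting multiples of row $k$ from rows $k+1,\dots,n$, giving $A^{(k+1)}$. $\Pi(A)\in\{0,\dots,n-1\}$ is the number of pivot movements used by GEPP on $A$, i.e. the number of $k\in\{1,\dots,n-1\}$ with $i_k>k$. $\Upsilon_n$ has the Stirling-1 distribution: $\mathbb P(\Upsilon_n=k)=|s(n,k)|/n!$ for $k=1,\dots,n$, where $s(n,k)$ is the Stirling number of the first kind, i.e. $x(x+1)\cdots(x+n-1)=\sum_{k=0}^n|s(n,k)|x^k$. *)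

(* Defs.v *)
From HB Require Import structures.
From mathcomp Require Import all_boot all_order all_algebra.
From mathcomp Require Import all_classical all_reals all_analysis.
From mathcomp Require Import complex.

Set Implicit Arguments.
Unset Strict Implicit.
Unset Printing Implicit Defensive.

Import Order.TTheory GRing.Theory Num.Theory.
Import numFieldNormedType.Exports.

Local Open Scope classical_set_scope.
Local Open Scope ring_scope.

(* Rows, columns and steps are numbered from 0 instead of 1. The field [F] is
   meant to be [R] or [R[i]]; on [R[i]] the relation [<=] is only a partial
   order, but any two norms are comparable. *)

(* If [B k k = 0], partial pivoting has left nothing to eliminate in column
   [k]; this agrees with the convention [x / 0 = 0]. *)
Definition eliminate (F : numFieldType) (n : nat) (k : 'I_n) (B : 'M[F]_n) :
    'M[F]_n :=
  \matrix_(i < n, j < n)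
    if (k < i)%N then B i j - B i k / B k k * B k j else B i j.

(* The matrix obtained after [m] steps when the pivot row at step [k] is
   [p k]; there is nothing left to do once [m >= n]. *)
Fixpoint gepp_matrix (F : numFieldType) (n : nat) (p : 'I_n -> 'I_n)
    (A : 'M[F]_n) (m : nat) : 'M[F]_n :=
  if m is m'.+1 then
    let B := gepp_matrix p A m' in
    if insub m' is Some k then eliminate k (xrow k (p k) B) else B
  else A.

(* [i] is an admissible pivot row at step [k] for the current matrix [B]. *)
Definition pivot_choice (F : numFieldType) (n : nat) (B : 'M[F]_n)
    (k i : 'I_n) : Prop :=
  [/\ (k <= i)%N,
      forall j : 'I_n, (k <= j)%N -> `|B j k| <= `|B i k| &
      (forall j : 'I_n, (k <= j)%N -> `|B j k| <= `|B k k|) -> i = k].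

(* [p] is a sequence of pivot rows that partial pivoting may select on [A].
   It need not be unique, because the maximal modulus may be attained
   several times. *)
Definition gepp_pivots (F : numFieldType) (n : nat) (A : 'M[F]_n)
    (p : 'I_n -> 'I_n) : Prop :=
  forall k : 'I_n, (k.+1 < n)%N -> pivot_choice (gepp_matrix p A k) k (p k).

Definition pivot_movements (n : nat) (p : 'I_n -> 'I_n) : nat :=
  #|[set k : 'I_n | (k.+1 < n)%N && (k < p k)%N]%SET|.

(* [n] by [n] matrices with their Borel sigma-algebra. *)
Definition borel_mx (F : numFieldType) (n : nat) : measurableType _ :=
  g_sigma_algebraType (@open 'M[F]_n).

Definition orthogonal_group (R : realType) (n : nat) : set 'M[R]_n :=
  [set g | g *m g^T = 1%:M].

Definition unitary_group (R : realType) (n : nat) : set 'M[R[i]]_n :=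
  [set g | g \is unitarymx].

(* The normalized Haar measure of a compact group [G] of matrices, seen as a
   Borel measure on the space of all matrices that is carried by [G]. The
   preimage of [B] under multiplication by [g] is the translate of [B] by the
   inverse of [g]. *)
Definition is_haar (R : realType) (F : numFieldType) (n : nat)
    (G : set 'M[F]_n) (mu : probability (borel_mx F n) R) : Prop :=
  mu G = 1%E /\
  forall (g : 'M[F]_n) (B : set (borel_mx F n)), G g -> measurable B ->
    mu ((fun x : 'M[F]_n => g *m x) @^-1` B) = mu B.

(* The unsigned Stirling number of the first kind [|s(n, k)|]. *)
Definition stirling1 (n k : nat) : nat :=
  ((\prod_(i < n) ('X + (i : nat)%:P) : {poly nat})`_k)%R.

Definition stirling1_distributed (R : realType) (d : measure_display)
    (U : measurableType d) (Q : probability U R) (n : nat)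
    (Y : {RV Q >-> nat}) : Prop :=
  forall k : nat, (1 <= k <= n)%N ->
    Q (Y @^-1` [set k]) = ((stirling1 n k)%:R / (n`!)%:R)%:E.

(* Equality in distribution of two functions that are measurable up to null
   sets, i.e. that are random variables for the completions of [P] and [Q].
   The common law does not depend on the versions [X'] and [Y']. *)
Definition eq_in_distribution (R : realType) (d d' : measure_display)
    (T : measurableType d) (U : measurableType d')
    (P : probability T R) (Q : probability U R)
    (X : T -> R) (Y : U -> R) : Prop :=
  exists (X' : {RV P >-> R}) (Y' : {RV Q >-> R}),
    [/\ {ae P, forall w, X w = X' w}, {ae Q, forall w, Y w = Y' w} &
        forall B : set R, measurable B ->
          distribution P X' B = distribution Q Y' B].

(* Main.v *)
Require Import Defs.
From HB Require Import structures.
From mathcomp Require Import all_boot all_order all_algebra.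
From mathcomp Require Import all_classical all_reals all_analysis.
From mathcomp Require Import complex.
From mathcomp Require Import perm ring zify.

Set Implicit Arguments.
Unset Strict Implicit.
Unset Printing Implicit Defensive.

Import Order.TTheory GRing.Theory Num.Theory.
Import numFieldNormedType.Exports.

Local Open Scope classical_set_scope.
Local Open Scope ring_scope.

(* Run GEPP along a prescribed sequence of pivot rows [p] with [k <= p k], and
   let S_p be the set of matrices on which, at every step, row [p k] strictly
   dominates column [k].

   Permuting the rows of a matrix only changes the swaps that bring the same
   pivot rows into place, so any two sets S_p and S_q are translates of each
   other by a permutation matrix and have the same Haar measure. They are
   pairwise disjoint, and they cover almost everything, because ties in the
   choice of a pivot are null: a tie |a| = |b| <> 0 between two rows is
   destroyed by rotating these two rows, and the translates of the tie event by
   infinitely many suitable rotations are disjoint but have the same measure.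
   Hence each S_p has measure 1/n!, and expanding
   [\prod_(k < n) ('X + (n - 1 - k))] counts the sequences [p] by their number
   of steps with [p k = k], that is, without pivot movement. *)

(** * Fraction-free Gaussian elimination *)

Section FractionFree.
Variables (F : numFieldType) (n : nat).
Implicit Types (A B C h : 'M[F]_n) (k i j : 'I_n) (p q : 'I_n -> 'I_n).

(* Elimination without division: up to a nonzero factor the active rows are
   those of GEPP, but the entries are polynomials in those of the original
   matrix, hence continuous. *)
Definition ff_eliminate k B : 'M[F]_n :=
  \matrix_(i < n, j < n)
    if (k < i)%N then B k k * B i j - B i k * B k j else B i j.

Fixpoint ff_matrix p A (m : nat) : 'M[F]_n :=
  if m is m'.+1 then
    let B := ff_matrix p A m' in
    if insub m' is Some k then ff_eliminate k (xrow k (p k) B) else B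
  else A.

Lemma ff_matrixS p A k :
  ff_matrix p A k.+1 = ff_eliminate k (xrow k (p k) (ff_matrix p A k)).
Proof. by rewrite /= valK. Qed.

Lemma gepp_matrixS p A k :
  gepp_matrix p A k.+1 = eliminate k (xrow k (p k) (gepp_matrix p A k)).
Proof. by rewrite /= valK. Qed.

Lemma xrowE2 k l B i j : xrow k l B i j = B (tperm k l i) j.
Proof. by rewrite mxE. Qed.

Definition strict_pivot B k i : Prop :=
  forall j, (k <= j)%N -> j != i -> `|B j k| < `|B i k|.

(** Dominance is tested on the fraction-free matrix, so that it is a strict inequality between
    continuous functions of [A]. *)
Definition strict_upto p (m : nat) : set 'M[F]_n :=
  [set A | forall k, (k < m)%N -> (k.+1 < n)%N ->
                     strict_pivot (ff_matrix p A k) k (p k)].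

Definition strict_set p : set 'M[F]_n := strict_upto p n.

(** At the last index this forces [p k = k], so a valid sequence is determined by the steps that
    GEPP performs. *)
Definition valid p : Prop := forall k, (k <= p k)%N.

Definition fixes_below (m : nat) (s : 'S_n) : Prop :=
  forall i, (i < m)%N -> s i = i.

Lemma fixes_below_ge m s i : fixes_below m s -> (m <= s i)%N = (m <= i)%N.
Proof.
move=> hs; apply: negb_inj; rewrite -!ltnNge; apply/idP/idP => hi.
  by have := hs _ hi => /perm_inj <-.
by rewrite hs.
Qed.

(** Every row below the pivot row is updated by the same formula, from itself and the pivot row
    alone. *)
Lemma ff_eliminate_row_perm k s C : fixes_below k.+1 s ->
  ff_eliminate k (row_perm s C) = row_perm s (ff_eliminate k C).
Proof.
move=> hs; apply/matrixP => i j; rewrite !mxE fixes_below_ge //.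
by rewrite (hs k).
Qed.

Lemma tperm_ge_fixes k i : (k <= i)%N -> fixes_below k (tperm k i).
Proof.
by move=> ki j jk; rewrite tpermD // -val_eqE /=; lia.
Qed.

Lemma strict_pivot_row_perm s B k i : fixes_below k s ->
  strict_pivot (row_perm s B) k i <-> strict_pivot B k (s i).
Proof.
move=> hs; split=> H j kj ji.
  have := H (s^-1 j)%g; rewrite !mxE permKV; apply.
    by rewrite -(fixes_below_ge (s^-1 j)%g hs) permKV.
  by apply: contraNneq ji => <-; rewrite permKV.
rewrite !mxE; apply: H; first by rewrite fixes_below_ge.
by rewrite (inj_eq perm_inj).
Qed.

(* Undoing the swaps of [p] and performing those of [q] turns an elimination
   along [p] into an elimination along [q]. *)
Lemma ff_matrix_row_perm p q m (s : 'S_n) : valid p -> valid q ->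
  (m <= n)%N -> fixes_below m s ->
  exists t : 'S_n, forall A,
    ff_matrix q (row_perm t A) m = row_perm s (ff_matrix p A m) /\
    (strict_upto q m (row_perm t A) <-> strict_upto p m A).
Proof.
move=> vp vq; elim: m s => [|m IH] s mn hs.
  by exists s => A; split => //; split => _ k.
pose k := Ordinal mn.
(* Chosen so that [s'] followed by the swap of [q] has the effect of the swap of [p] followed by
   [s]; in particular [s'] sends [q k] to [p k]. *)
pose s' := (tperm k (q k) * s * tperm k (p k))%g.
have hs' : fixes_below m s'.
  move=> i im; have im' := ltnW im; rewrite /s' !permM.
  by rewrite (tperm_ge_fixes (vq k) im) hs ?ltnS // (tperm_ge_fixes (vp k) im).
have [t ht] := IH s' (ltnW mn) hs'; exists t => A.
have [eB eS] := ht A; split.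
  have -> : m = k by [].
  rewrite !ff_matrixS /= eB -ff_eliminate_row_perm //; congr ff_eliminate.
  apply/matrixP => i j.
  by rewrite !mxE /s' !permM tpermK.
have s'q : s' (q k) = p k.
  by rewrite /s' !permM tpermR hs // tpermL.
have eqk : strict_pivot (ff_matrix q (row_perm t A) k) k (q k) <->
           strict_pivot (ff_matrix p A k) k (p k).
  by rewrite /= eB strict_pivot_row_perm // s'q.
split => H l; rewrite ltnS leq_eqVlt => /orP[/eqP lm | lm] ln.
- have -> : l = k by apply: val_inj.
  apply/eqk; apply: H => //; by rewrite /= -lm.
- by apply: (eS.1 _ l lm ln) => i im; apply: H; rewrite ltnS ltnW.
- have -> : l = k by apply: val_inj.
  apply/eqk; apply: H => //; by rewrite /= -lm.
- by apply: (eS.2 _ l lm ln) => i im; apply: H; rewrite ltnS ltnW.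
Qed.

(** One [t] serves all [A], so the two sets are translates under a single permutation matrix. *)
Lemma strict_set_row_perm p q : valid p -> valid q ->
  exists t : 'S_n, forall A, strict_set q (row_perm t A) <-> strict_set p A.
Proof.
move=> vp vq; have [|t ht] := @ff_matrix_row_perm p q n 1 vp vq (leqnn n).
  by move=> i _; rewrite perm1.
by exists t => A; have [] := ht A.
Qed.

(** Block diagonal matrices with an identity block of size [m] in the upper left corner: they act on
    the active rows only. *)
Definition block_below (m : nat) h : Prop :=
  forall i j, ((i < m) || (j < m))%N -> h i j = (i == j)%:R.

Lemma block_belowW m h : block_below m.+1 h -> block_below m h.
Proof. by move=> H i j ij; apply: H; lia. Qed.

Lemma block_below_mul m h g :
  block_below m h -> block_below m g -> block_below m (h *m g).
Proof.
move=> hh hg i j /orP[im|jm]; rewrite mxE.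
  rewrite (bigD1 i) //= hh ?im // eqxx mul1r big1 ?addr0 => [|l li].
    by rewrite hg ?im.
  by rewrite hh ?im // eq_sym (negPf li) mul0r.
rewrite (bigD1 j) //= [g j j]hg ?jm ?orbT // eqxx mulr1 big1 ?addr0 => [|l li].
  by rewrite hh ?jm ?orbT.
by rewrite [g l j]hg ?jm ?orbT // (negPf li) mulr0.
Qed.

Lemma block_below_tperm k i : (k <= i)%N -> block_below k (tperm_mx k i).
Proof.
move=> ki r j; rewrite !mxE => rj; suff -> : (tperm k i r == j) = (r == j) by [].
case/orP: rj => H; first by rewrite (tperm_ge_fixes ki H).
by rewrite -(inj_eq (@perm_inj _ (tperm k i))) tpermK (tperm_ge_fixes ki H).
Qed.

(** The pivot row is fixed by [h], the rows below it are mixed only among themselves, and their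
    update is linear. *)
Lemma ff_eliminate_mul k h C : block_below k.+1 h ->
  ff_eliminate k (h *m C) = h *m ff_eliminate k C.
Proof.
move=> hh; have rowk i j D : (i <= k)%N -> (h *m D) i j = D i j.
  move=> ik; rewrite mxE (bigD1 i) //= hh ?ltnS ?ik // eqxx mul1r.
  rewrite big1 ?addr0 // => l li.
  by rewrite hh ?ltnS ?ik // eq_sym (negPf li) mul0r.
apply/matrixP => i j; rewrite [LHS]mxE; case: ltnP => ik; last first.
  by rewrite !rowk // mxE ltnNge ik.
rewrite (rowk k) // (rowk k) // ![(h *m _) i _]mxE mulr_sumr mulr_suml -sumrB.
apply: eq_bigr => l _; rewrite mxE; case: ltnP => kl.
  ring.
rewrite (hh i l) ?ltnS ?kl ?orbT //.
have -> : (i == l) = false by rewrite -val_eqE /=; lia.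
by rewrite !mul0r mulr0 subrr.
Qed.

(* A transformation of the rows not yet used as pivots at step [m] is induced
   by a transformation of the original matrix in the same group. *)
Lemma ff_matrix_lift (G : set 'M[F]_n) p m h :
  (forall g g', G g -> G g' -> G (g *m g')) ->
  (forall k i, G (tperm_mx k i)) -> valid p ->
  (m <= n)%N -> G h -> block_below m h ->
  exists2 g, G g & forall A, ff_matrix p (g *m A) m = h *m ff_matrix p A m.
Proof.
move=> GM Gt vp; elim: m h => [|m IH] h mn Gh hh; first by exists h.
pose k := Ordinal mn; pose t : 'M[F]_n := tperm_mx k (p k).
(* The swap [t] of this step is an involution, so it turns the conjugate [t *m h *m t] back into
   [h]. *)
have [|| g Gg gP] := IH (t *m h *m t) (ltnW mn).
- by apply: (GM) (Gt _ _); apply: GM (Gt _ _) Gh.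
- have bt : block_below m t by exact: (block_below_tperm (vp k)).
  apply: block_below_mul => //; apply: block_below_mul => //.
  exact: block_belowW.
exists g => // A; have -> : m = k by [].
rewrite !ff_matrixS /= gP -ff_eliminate_mul // !xrowE -/t.
by rewrite !mulmxA -perm_mxM tperm2 perm_mx1 mul1mx.
Qed.

(** Elimination is left multiplication by a lower triangular matrix whose diagonal entries are 1 or
    the pivot. *)
Lemma ff_eliminate_unit k B :
  B k k != 0 -> B \in unitmx -> ff_eliminate k B \in unitmx.
Proof.
move=> Bk uB.
pose L : 'M[F]_n := \matrix_(i < n, j < n)
  if (k < i)%N then B k k * (i == j)%:R - B i k * (k == j)%:R
  else (i == j)%:R.
have -> : ff_eliminate k B = L *m B.
  apply/matrixP => i j; rewrite !mxE.
  under eq_bigr => l _ do rewrite mxE.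
  case: ltnP => ki.
    under eq_bigr => l _ do rewrite mulrBl -!mulrA.
    rewrite sumrB -!mulr_sumr (bigD1 i) //= eqxx mul1r big1 => [|l li]; last first.
      by rewrite eq_sym (negPf li) mul0r.
    rewrite (bigD1 k) //= eqxx mul1r big1 => [|l li]; last first.
      by rewrite eq_sym (negPf li) mul0r.
    by rewrite !addr0.
  rewrite (bigD1 i) //= eqxx mul1r big1 ?addr0 // => l li.
  by rewrite eq_sym (negPf li) mul0r.
rewrite unitmx_mul uB andbT unitmxE unitfE det_trig; last first.
  apply/is_trig_mxP => i j ij; rewrite mxE.
  have -> : (i == j) = false by rewrite -val_eqE /=; lia.
  case: ltnP => // ki; have -> : (k == j) = false by rewrite -val_eqE /=; lia.
  by rewrite !mulr0 subrr.
apply/prodf_neq0 => i _; rewrite mxE eqxx; case: ltnP => ki; last exact: oner_neq0.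
have -> : (k == i) = false by rewrite -val_eqE /=; lia.
by rewrite mulr1 mulr0 subr0.
Qed.

Lemma ff_eliminate_col0 k B (i : 'I_n) : (k < i)%N -> ff_eliminate k B i k = 0.
Proof. by move=> ki; rewrite mxE ki mulrC subrr. Qed.

(* By the pigeonhole principle every term of the Leibniz expansion of the
   determinant would vanish. *)
Lemma unit_pivot_exists B k : B \in unitmx ->
  (forall i j : 'I_n, (j < k)%N -> (j < i)%N -> B i j = 0) ->
  exists2 i : 'I_n, (k <= i)%N & B i k != 0.
Proof.
move=> uB ut; apply: contrapT => no.
have col0 i : (k <= i)%N -> B i k = 0.
  by move=> ki; apply/eqP; apply/negPn/negP => Bi; apply: no; exists i.
move: uB; rewrite unitmxE unitfE => /negP; apply; apply/eqP.
rewrite /determinant big1 // => s _.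
suff [i /eqP Bi] : exists i, B i (s i) == 0.
  by rewrite (bigD1 i) //= Bi mul0r mulr0.
apply: contrapT => nz.
(* In the rows of index at least [k] all columns up to [k] vanish, so a nonzero term must send these
   rows strictly beyond [k]. *)
have H i : (k <= i)%N -> (k < s i)%N.
  move=> ki; rewrite ltnNge; apply/negP => sk; apply: nz; exists i.
  move: sk; rewrite leq_eqVlt => /orP[/eqP/val_inj ->|sk].
    by rewrite col0.
  by rewrite ut //; apply: leq_trans ki.
have /subset_leq_card : (s @: [set i : 'I_n | (k <= i)%N]
    \subset [set i : 'I_n | (k < i)%N])%SET.
  by apply/fintype.subsetP => _ /imsetP[i + ->]; rewrite !inE; exact: H.
rewrite (card_imset _ (@perm_inj _ s)) leqNgt => /negP; apply.
apply: proper_card; apply/properP; split.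
  by apply/fintype.subsetP => i; rewrite !inE => /ltnW.
by exists k; rewrite !inE ?leqnn ?ltnn.
Qed.

End FractionFree.

(** * Comparison of strict pivoting with GEPP *)

Section Pivoting.
Variables (F : numFieldType) (n : nat).
Implicit Types (A B : 'M[F]_n) (k i j : 'I_n) (p q : 'I_n -> 'I_n).

(** Before the last step there is another active row, whose modulus is nonnegative and strictly
    smaller. *)
Lemma strict_pivot_neq0 B k i :
  (k.+1 < n)%N -> strict_pivot B k i -> B i k != 0.
Proof.
move=> kn H; have [j kj ji] : exists2 j : 'I_n, (k <= j)%N & j != i.
  have [->|ki] := eqVneq i k; last by exists k; rewrite // eq_sym.
  by exists (Ordinal kn) => //=; rewrite -val_eqE /=; lia.
by rewrite -normr_gt0; apply: le_lt_trans (H j kj ji).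
Qed.

Lemma ff_matrix_gepp p A m : valid p -> (m < n)%N -> strict_upto p m A ->
  exists2 c : F, c != 0 & forall i j, (m <= i)%N ->
    ff_matrix p A m i j = c * gepp_matrix p A m i j.
Proof.
move=> vp; elim: m => [|m IH] mn H.
  by exists 1 => [|i j _]; rewrite ?oner_neq0 // mul1r.
have [|c c0 cP] := IH (ltnW mn); first by move=> k km; apply: H; rewrite ltnS ltnW.
pose k := Ordinal (ltnW mn).
set B := gepp_matrix p A m in cP *; set C := ff_matrix p A m in cP *.
have ge i : (k <= i)%N -> (k <= tperm k (p k) i)%N.
  by rewrite (fixes_below_ge _ (tperm_ge_fixes (vp k))).
have cx i j : (k <= i)%N ->
    xrow k (p k) C i j = c * xrow k (p k) B i j.
  by move=> ki; rewrite !xrowE2 cP //; exact: ge.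
have Bk : xrow k (p k) B k k != 0.
  have : C (p k) k != 0 by apply: strict_pivot_neq0 => //; apply: H => /=.
  by rewrite xrowE2 tpermL cP ?mulf_eq0 ?negb_or ?c0 //; exact: vp.
(* Each product of two entries contributes [c ^+ 2], and clearing the denominator contributes the
   pivot. *)
exists (c ^+ 2 * xrow k (p k) B k k) => [|i j mi].
  by rewrite mulf_neq0 ?expf_neq0.
rewrite -[m.+1]/(k.+1) ff_matrixS gepp_matrixS !mxE -/B -/C.
have -> : (k < i)%N by [].
move: (cx k k (leqnn k)) (cx i j (ltnW mi)) (cx i k (ltnW mi)) (cx k j (leqnn k)).
move: Bk; rewrite !mxE => Bk -> -> -> ->; field.
by rewrite Bk.
Qed.

Lemma gepp_matrix_eq p q A m :
  (forall k, (k < m)%N -> p k = q k) -> gepp_matrix p A m = gepp_matrix q A m.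
Proof.
elim: m => //= m IH pq; rewrite IH => [|k km]; last by apply: pq; rewrite ltnS ltnW.
by case: insubP => // k _ km; rewrite pq // -km.
Qed.

Lemma strict_pivot_gepp p A k : valid p -> (k.+1 < n)%N -> strict_set p A ->
  strict_pivot (gepp_matrix p A k) k (p k).
Proof.
move=> vp kn H; have [|c c0 cP] := @ff_matrix_gepp p A k vp (ltn_ord k).
  by move=> l lk; apply: H.
move=> j kj jp; have := H k (ltn_ord k) kn j kj jp.
by rewrite !cP // !normrM ltr_pM2l // normr_gt0.
Qed.

Lemma strict_set_pivots p A : valid p -> strict_set p A -> gepp_pivots A p.
Proof.
move=> vp H k kn; have S := strict_pivot_gepp vp kn H.
split=> [|j kj|mx]; first exact: vp.
  by have [->//|/(S j kj)/ltW] := eqVneq j (p k).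
apply/eqP/negPn/negP => pk; rewrite eq_sym in pk.
have := lt_le_trans (S k (leqnn k) pk) (mx _ (vp k)).
by rewrite ltxx.
Qed.

(** By strong induction on [k], both sequences have produced the same matrix, in which only one row
    attains the maximal modulus. *)
Lemma strict_set_pivots_unique p q A : valid p -> strict_set p A ->
  gepp_pivots A q -> forall k, (k.+1 < n)%N -> q k = p k.
Proof.
move=> vp H gq k; move: {2}(k : nat) (leqnn k) => m; elim: m k => [|m IH] k km kn.
all: have eB : gepp_matrix q A k = gepp_matrix p A k
  by apply: gepp_matrix_eq => l lk; [lia || (apply: IH; lia)].
all: have [kq mx _] := gq k kn; apply/eqP/negPn/negP => qp.
all: have := strict_pivot_gepp vp kn H kq qp; rewrite -eB => lt.
all: by have := lt_le_trans lt (mx _ (vp k)); rewrite ltxx.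
Qed.

Lemma strict_set_inj p q A : valid p -> valid q ->
  strict_set p A -> strict_set q A -> p =1 q.
Proof.
move=> vp vq Hp Hq k; have [kn|nk] := ltnP k.+1 n.
  exact: (strict_set_pivots_unique vq Hq (strict_set_pivots vp Hp)).
have := vp k; have := vq k; have := ltn_ord (p k); have := ltn_ord (q k).
by move=> *; apply: val_inj => /=; lia.
Qed.

(** Ties between zeros are left out: no combination of the two rows breaks them. For an invertible
    matrix they do not affect the maximal modulus, which is nonzero. *)
Definition tie_set p k i j : set 'M[F]_n :=
  [set A | `|ff_matrix p A k i k| = `|ff_matrix p A k j k| /\
           ff_matrix p A k i k != 0].

Lemma ff_matrix_upper p A m : valid p -> (m <= n)%N ->
  forall i j, (j < m)%N -> (j < i)%N -> ff_matrix p A m i j = 0.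
Proof.
move=> vp; elim: m => [//|m IH] mn i j jm ji.
pose k := Ordinal mn; rewrite -[m.+1]/(k.+1) ff_matrixS.
have [jk|jk] := ltnP j k; last first.
  have jkE : j = k by apply: val_inj => /=; move: jm jk => /=; lia.
  by rewrite jkE ff_eliminate_col0 // -jkE.
have x0 (l : 'I_n) : (j < l)%N -> xrow k (p k) (ff_matrix p A k) l j = 0.
  move=> jl; rewrite xrowE2 /= IH //; first exact: ltnW.
  by case: tpermP => // _; apply: leq_trans jk _; rewrite // vp.
by rewrite mxE; case: ltnP => _; rewrite !x0 // !mulr0 subrr.
Qed.

(** Invertibility, carried along the elimination, makes the maximal modulus nonzero; without ties it
    is then attained once. *)
Lemma pivots_strict_set p A : valid p -> A \in unitmx ->
  (forall k i j, (k <= i)%N -> (k <= j)%N -> i != j -> ~ tie_set p k i j A) ->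
  gepp_pivots A p -> strict_set p A.
Proof.
move=> vp uA nt gp.
(* Invertibility is claimed only for [m < n], since strict dominance gives a nonzero pivot only
   before the last step. *)
suff H m : (m <= n)%N -> strict_upto p m A /\
    ((m < n)%N -> ff_matrix p A m \in unitmx) by case: (H n).
elim: m => [//|m IH] mn; have [Sm um] := IH (ltnW mn).
pose k := Ordinal mn; have um' := um mn.
have Sk : (k.+1 < n)%N -> strict_pivot (ff_matrix p A k) k (p k).
  move=> kn; have [_ mx _] := gp k kn.
  have [c c0 cP] := ff_matrix_gepp vp mn Sm.
  have mxf j : (k <= j)%N ->
      `|ff_matrix p A k j k| <= `|ff_matrix p A k (p k) k|.
    move=> kj; rewrite /= !cP //; last exact: vp.
    by rewrite !normrM ler_pM2l ?normr_gt0 //; exact: mx.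
  have [i ki Bi] := unit_pivot_exists (k := k) um' (@ff_matrix_upper p A m vp (ltnW mn)).
  have Bp : ff_matrix p A k (p k) k != 0.
    by rewrite -normr_gt0; apply: lt_le_trans (mxf i ki); rewrite normr_gt0.
  move=> j kj jp; rewrite lt_neqAle mxf // andbT; apply/eqP => e.
  by apply: (nt k (p k) j) => //; rewrite // eq_sym.
split=> [l|mn'].
  rewrite ltnS leq_eqVlt => /orP[/eqP lm ln|]; last exact: Sm.
  by have -> : l = k by [apply: val_inj]; apply: Sk; rewrite /= -lm.
rewrite -[m.+1]/(k.+1) ff_matrixS; apply: ff_eliminate_unit.
  by rewrite xrowE2 tpermL; apply: strict_pivot_neq0 => //; exact: Sk.
by rewrite xrowE unitmx_mul unitmx_perm.
Qed.

End Pivoting.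

(** * Measurability *)

Section Borel.
Variables (F : numFieldType) (n : nat).

(** Moving both values by less than half of the gap keeps the inequality. The triangle inequality is
    applied directly, as the order of [F] may be partial. *)
Lemma open_norm_lt (T : topologicalType) (f g : T -> F) :
  continuous f -> continuous g -> open [set x | `|f x| < `|g x|].
Proof.
move=> cf cg; rewrite openE => x /= fg.
pose e := (`|g x| - `|f x|) / 2.
have e0 : 0 < e by rewrite divr_gt0 // subr_gt0.
have nf : \forall y \near x, `|f x - f y| < e.
  by have /cvgrPdist_lt := cf x; exact.
have ng : \forall y \near x, `|g x - g y| < e.
  by have /cvgrPdist_lt := cg x; exact.
apply: filterS2 nf ng => y nf ng /=.
have -> : `|f y| = `|f x - (f x - f y)| by rewrite subKr.
have -> : `|g y| = `|g x - (g x - g y)| by rewrite subKr.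
apply: le_lt_trans (ler_normB _ _) _.
apply: lt_le_trans (lerB_dist _ _).
rewrite ltrBrDr -addrA -ltrBrDl; apply: lt_le_trans (ltrD nf ng) _.
by rewrite /e -splitr.
Qed.

Lemma measurable_open (S : set 'M[F]_n) :
  open S -> measurable (S : set (borel_mx F n)).
Proof. by move=> oS; apply: sub_sigma_algebra. Qed.

Lemma measurable_norm_lt (f g : 'M[F]_n -> F) : continuous f -> continuous g ->
  measurable ([set x | `|f x| < `|g x|] : set (borel_mx F n)).
Proof. by move=> cf cg; apply: measurable_open; exact: open_norm_lt. Qed.

Lemma measurable_neq0 (f : 'M[F]_n -> F) : continuous f ->
  measurable ([set x | f x != 0] : set (borel_mx F n)).
Proof.
move=> cf; have -> : [set x | f x != 0] = [set x | `|cst 0 x : F| < `|f x|].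
  by apply/seteqP; split=> x /=; rewrite normr0 normr_gt0.
by apply: measurable_norm_lt => // x; exact: cst_continuous.
Qed.

Lemma measurable_eq0 (f : 'M[F]_n -> F) : continuous f ->
  measurable ([set x | f x = 0] : set (borel_mx F n)).
Proof.
move=> cf; rewrite (_ : mkset _ = ~` [set x | f x != 0]).
  by apply: measurableC; exact: measurable_neq0.
by apply/seteqP; split=> x /=; [move=> ->; rewrite eqxx | move=> /negP/negPn/eqP].
Qed.

Lemma continuous_mul (T : topologicalType) (f g : T -> F) :
  continuous f -> continuous g -> continuous (fun x => f x * g x).
Proof. by move=> cf cg x; apply: continuousM; [exact: cf|exact: cg]. Qed.

Lemma continuous_sub (T : topologicalType) (f g : T -> F) :
  continuous f -> continuous g -> continuous (fun x => f x - g x).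
Proof. by move=> cf cg x; apply: continuousB; [exact: cf|exact: cg]. Qed.

Lemma continuous_add (T : topologicalType) (f g : T -> F) :
  continuous f -> continuous g -> continuous (fun x => f x + g x).
Proof. by move=> cf cg x; apply: continuousD; [exact: cf|exact: cg]. Qed.

Lemma continuous_normr (T : topologicalType) (f : T -> F) :
  continuous f -> continuous (fun x => `|f x|).
Proof. by move=> cf x; apply: cvg_norm; exact: cf. Qed.

Lemma continuous_big_sum (T : topologicalType) (I : finType) (f : I -> T -> F) :
  (forall i, continuous (f i)) -> continuous (fun x => \sum_i f i x).
Proof.
move=> cf; elim: (index_enum I) => [|i s IH].
  by under eq_fun do rewrite big_nil; move=> x; exact: cst_continuous.
under eq_fun do rewrite big_cons; exact: continuous_add.
Qed.

Lemma ff_matrix_continuous (p : 'I_n -> 'I_n) m (i j : 'I_n) :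
  continuous (fun A : 'M[F]_n => ff_matrix p A m i j).
Proof.
elim: m i j => [|m IH] i j /=; first exact: coord_continuous.
case: insubP => [k _ _|_]; last exact: IH.
have cx l r : continuous (fun A : 'M[F]_n => xrow k (p k) (ff_matrix p A m) l r).
  by under eq_fun do rewrite xrowE2; exact: IH.
under eq_fun do rewrite mxE; case: (k < i)%N; last exact: cx.
by apply: continuous_sub; apply: continuous_mul.
Qed.

Lemma strict_set_measurable (p : 'I_n -> 'I_n) :
  measurable (strict_set p : set (borel_mx F n)).
Proof.
rewrite (_ : strict_set p = \bigcap_(k in [set k : 'I_n | (k.+1 < n)%N])
  \bigcap_(j in [set j : 'I_n | (k <= j)%N /\ j != p k])
  [set A | `|ff_matrix p A k j k| < `|ff_matrix p A k (p k) k|]).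
  apply: fin_bigcap_measurable => [|k _]; first exact: finite_finset.
  apply: fin_bigcap_measurable => [|j _]; first exact: finite_finset.
  by apply: measurable_norm_lt; exact: ff_matrix_continuous.
apply/seteqP; split=> A H k.
  by move=> /= kn j [kj jp]; exact: H.
by move=> _ kn j kj jp; apply: (H k kn j).
Qed.

End Borel.

(** * Rotations of two rows *)

Section RationalRotations.
Variable F : numFieldType.

(* Rational points of the unit circle, from Pythagorean triples. *)
Definition rot_cos (l : nat) : F := (l.+2%:R ^+ 2 - 1) / (l.+2%:R ^+ 2 + 1).
Definition rot_sin (l : nat) : F := (2 * l.+2%:R) / (l.+2%:R ^+ 2 + 1).

Lemma rot_den_gt0 l : 0 < l.+2%:R ^+ 2 + 1 :> F.
Proof. by rewrite ltr_wpDl // exprn_ge0. Qed.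

(** Starting the parameter at 2 keeps all angles inside the open first quadrant. *)
Lemma rot_cos_gt0 l : 0 < rot_cos l.
Proof.
rewrite divr_gt0 ?rot_den_gt0 // subr_gt0 -natrX ltr1n.
by rewrite -[1%N](exp1n 2) ltn_exp2r.
Qed.

Lemma rot_sin_gt0 l : 0 < rot_sin l.
Proof. by rewrite divr_gt0 ?rot_den_gt0 // mulr_gt0. Qed.

Lemma rot_cos2Dsin2 l : rot_cos l ^+ 2 + rot_sin l ^+ 2 = 1.
Proof. by rewrite /rot_cos /rot_sin; field; rewrite gt_eqF ?rot_den_gt0. Qed.

(* [c ^+ 2 - s ^+ 2] and [2 * c * s] are the cosine and the sine of the doubled
   angle; the lines in these doubled directions are pairwise distinct. *)
Lemma rot_independent l m (x y : F) : l != m ->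
  (rot_cos l ^+ 2 - rot_sin l ^+ 2) * x = 2 * rot_cos l * rot_sin l * y ->
  (rot_cos m ^+ 2 - rot_sin m ^+ 2) * x = 2 * rot_cos m * rot_sin m * y ->
  x = 0 /\ y = 0.
Proof.
move=> lm; set c := rot_cos l; set s := rot_sin l.
set c' := rot_cos m; set s' := rot_sin m => e e'.
(* Up to a constant factor this is the determinant of the system, namely the sine times the cosine
   of the difference of the two angles; Cramer's rule then applies. *)
have K : (c * s' - s * c') * (c * c' + s * s') != 0.
  apply: mulf_neq0; last first.
    by rewrite gt_eqF // addr_gt0 // mulr_gt0 ?rot_cos_gt0 ?rot_sin_gt0.
  have -> : c * s' - s * c' = 2 * (l.+2%:R - m.+2%:R) * (l.+2%:R * m.+2%:R + 1) /
      ((l.+2%:R ^+ 2 + 1) * (m.+2%:R ^+ 2 + 1)).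
    rewrite /c /s /c' /s' /rot_cos /rot_sin; field.
    by rewrite !gt_eqF ?rot_den_gt0.
  rewrite !mulf_neq0 ?invr_eq0 ?pnatr_eq0 //.
  by rewrite subr_eq0 eqr_nat; lia.
split; apply: (mulfI K); rewrite mulr0.
  have -> : (c * s' - s * c') * (c * c' + s * s') * x =
     c' * s' * ((c ^+ 2 - s ^+ 2) * x) - c * s * ((c' ^+ 2 - s' ^+ 2) * x).
    by ring.
  by rewrite e e'; ring.
have n2 : (2 : F) != 0 by rewrite pnatr_eq0.
apply: (mulfI n2); rewrite mulr0.
have -> : 2 * ((c * s' - s * c') * (c * c' + s * s') * y) =
   (c ^+ 2 - s ^+ 2) * (2 * c' * s' * y) - (c' ^+ 2 - s' ^+ 2) * (2 * c * s * y).
  by ring.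
by rewrite -e -e'; ring.
Qed.

End RationalRotations.

(** * Orthogonal and unitary groups, treated uniformly through an involution *)

Section StarGroup.
Variables (F : numFieldType) (n : nat) (star : {rmorphism F -> F}).
Hypothesis starE : forall x, x * star x = `|x| ^+ 2.

(* The orthogonal group if [star] is the identity, the unitary group if [star]
   is the complex conjugation. *)
Definition star_group : set 'M[F]_n :=
  [set g | g *m (map_mx star g)^T = 1%:M].

Lemma star_groupM g h : star_group g -> star_group h -> star_group (g *m h).
Proof.
move=> Gg Gh; rewrite /star_group /= map_mxM trmx_mul mulmxA.
by rewrite -(mulmxA g) [h *m _]Gh mulmx1.
Qed.

Lemma star_group_perm (s : 'S_n) : star_group (perm_mx s).
Proof.
by rewrite /star_group /= map_perm_mx tr_perm_mx -perm_mxM mulgV perm_mx1.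
Qed.

Lemma star_group_unit g : star_group g -> g \in unitmx.
Proof. by move=> /mulmx1_unit[]. Qed.

Lemma normr_star x : `|star x| = `|x|.
Proof.
have [->|x0] := eqVneq x 0; first by rewrite rmorph0.
have x1 : `|x| != 0 by rewrite normr_eq0.
by apply: (mulfI x1); rewrite -normrM starE normrX normr_id.
Qed.

(** An additive map that preserves the norm is an isometry. *)
Lemma star_continuous : continuous star.
Proof.
move=> x S /nbhs_ballP[e e0 eS]; apply/nbhs_ballP; exists e => // y xy.
by apply: eS; move: xy; rewrite -ball_normE /= -rmorphB normr_star.
Qed.

Lemma star_group_measurable : measurable (star_group : set (borel_mx F n)).
Proof.
rewrite (_ : star_group = \bigcap_(i in [set: 'I_n])
  \bigcap_(j in [set: 'I_n])
  [set A | \sum_k A i k * star (A j k) - (i == j)%:R = 0]).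
  apply: fin_bigcap_measurable => [|i _]; first exact: finite_finset.
  apply: fin_bigcap_measurable => [|j _]; first exact: finite_finset.
  apply: measurable_eq0; apply: continuous_sub; last by move=> ?; exact: cst_continuous.
  apply: continuous_big_sum => k; apply: continuous_mul.
    exact: coord_continuous.
  move=> x; apply: continuous_comp; first exact: coord_continuous.
  exact: star_continuous.
apply/seteqP; split=> A /= H.
  move=> i _ j _ /=; have /matrixP/(_ i j) := H.
  rewrite !mxE => <-; apply/eqP; rewrite subr_eq0; apply/eqP.
  by apply: eq_bigr => k _; rewrite !mxE.
apply/matrixP => i j; rewrite !mxE; have /= /eqP := H i I j I.
by rewrite subr_eq0 => /eqP <-; apply: eq_bigr => k _; rewrite !mxE.
Qed.

(** For distinct [i] and [j], the identity matrix with the block [[a, b], [c, d]] inserted at rows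
    and columns [i], [j], as for a Givens rotation. *)
Definition mix_mx (i j : 'I_n) (a b c d : F) : 'M[F]_n :=
  \matrix_(r, l) if r == i then a * (l == i)%:R + b * (l == j)%:R
    else if r == j then c * (l == i)%:R + d * (l == j)%:R else (r == l)%:R.

Lemma mix_mxM i j a b c d (X : 'M[F]_n) r l :
  (mix_mx i j a b c d *m X) r l =
    if r == i then a * X i l + b * X j l
    else if r == j then c * X i l + d * X j l else X r l.
Proof.
have sum_delta k (x : F) : \sum_t x * (t == k)%:R * X t l = x * X k l.
  rewrite (bigD1 k) //= eqxx mulr1 big1 ?addr0 // => t tk.
  by rewrite (negPf tk) mulr0 mul0r.
rewrite mxE; under eq_bigr => t _ do rewrite mxE.
case: ifP => _; last case: ifP => _.
- by under eq_bigr => t _ do rewrite mulrDl; rewrite big_split /= !sum_delta.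
- by under eq_bigr => t _ do rewrite mulrDl; rewrite big_split /= !sum_delta.
- rewrite -[RHS]mul1r -sum_delta; apply: eq_bigr => t _.
  by rewrite mul1r eq_sym.
Qed.

Definition unitary2 (a b c d : F) : Prop :=
  [/\ a * star a + b * star b = 1, a * star c + b * star d = 0,
      c * star a + d * star b = 0 & c * star c + d * star d = 1].

Lemma mix_mx_star_group i j a b c d : i != j -> unitary2 a b c d ->
  star_group (mix_mx i j a b c d).
Proof.
move=> ij [h1 h2 h3 h4]; have ji : (j == i) = false by rewrite eq_sym (negPf ij).
apply/matrixP => r l; rewrite mix_mxM !mxE !eqxx ji.
rewrite (negPf ij); have [->|ri] := eqVneq r i; last have [->|rj] := eqVneq r j.
- rewrite (eq_sym i l); have [_|_] := eqVneq l i.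
    by rewrite /= !(mulr1n, mulr0n, mulr1, mulr0, addr0, add0r).
  have [_|_] := eqVneq l j.
    by rewrite /= !(mulr1n, mulr0n, mulr1, mulr0, addr0, add0r).
  by rewrite !rmorph0 !mulr0 addr0.
- rewrite (eq_sym j l); have [->|_] := eqVneq l i.
    by rewrite (negPf ij) /= !(mulr1n, mulr0n, mulr1, mulr0, addr0, add0r).
  have [_|_] := eqVneq l j.
    by rewrite /= !(mulr1n, mulr0n, mulr1, mulr0, addr0, add0r).
  by rewrite !rmorph0 !mulr0 addr0.
- have [->|_] := eqVneq l i.
    by rewrite /= ?(negPf ri) ?(negPf rj) !mulr0 addr0 rmorph0.
  have [->|_] := eqVneq l j.
    by rewrite /= ?(negPf ri) ?(negPf rj) !mulr0 addr0 rmorph0.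
  by rewrite rmorph_nat eq_sym.
Qed.

Lemma mix_mx_block m (i j : 'I_n) a b c d : (m <= i)%N -> (m <= j)%N ->
  block_below m (mix_mx i j a b c d).
Proof.
move=> mi mj r l rl; rewrite mxE; case: eqP => [ri|_]; last case: eqP => [rj|//].
  have lm : (l < m)%N by move: rl; rewrite ri ltnNge mi.
  have -> : (l == i) = false by rewrite -val_eqE /=; lia.
  have -> : (l == j) = false by rewrite -val_eqE /=; lia.
  have -> : (r == l) = false by rewrite ri -val_eqE /=; lia.
  by rewrite !mulr0 addr0.
have lm : (l < m)%N by move: rl; rewrite rj ltnNge mj.
have -> : (l == i) = false by rewrite -val_eqE /=; lia.
have -> : (l == j) = false by rewrite -val_eqE /=; lia.
have -> : (r == l) = false by rewrite rj -val_eqE /=; lia.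
by rewrite !mulr0 addr0.
Qed.

End StarGroup.

(** * Ties are null *)

Section Haar.
Variables (R : realType) (F : numFieldType) (n : nat).
Variable star : {rmorphism F -> F}.
Hypothesis starE : forall x, x * star x = `|x| ^+ 2.
Hypothesis star_id_or_i :
  (forall x, star x = x) \/ exists2 i : F, star i = - i & i * i = -1.

Local Notation G := (@star_group F n star).

Variable mu : probability (borel_mx F n) R.
Hypothesis mu_haar : is_haar G mu.

(** The union of [N] disjoint copies has measure at most 1, so [N] times the measure of [S] is at
    most 1 for every [N]. *)
Lemma null_of_disjoint_copies (E : (set (borel_mx F n))^nat)
    (S : set (borel_mx F n)) :
  (forall l, measurable (E l)) -> trivIset setT E ->
  (forall l, mu (E l) = mu S) -> measurable S -> mu S = 0%E.
Proof.
move=> mE tE eE mS; have fS : mu S \is a fin_num by exact: fin_num_measure.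
have H N : (fine (mu S) *+ N <= 1)%R.
  have : (mu (\big[setU/set0]_(i < N) E i) <= 1)%E.
    by apply: probability_le1; apply: bigsetU_measurable.
  rewrite measure_bigsetU //.
  rewrite (eq_bigr (fun=> (fine (mu S))%:E)) => [|l _]; last first.
    by rewrite fineK //; exact: eE.
  by rewrite sumEFin lee_fin sumr_const card_ord.
have r0 : (0 <= fine (mu S))%R by exact: fine_ge0.
rewrite -(fineK fS); congr EFin; apply/eqP; rewrite eq_le r0 andbT leNgt.
apply/negP => rp; have := H (Num.truncn (fine (mu S))^-1).+1.
rewrite leNgt => /negP; apply; rewrite -mulr_natl.
by rewrite -ltr_pdivrMr // div1r truncnS_gt.
Qed.

Section Ties.
Implicit Types a b : 'M[F]_n -> F.

Definition tie a b : set (borel_mx F n) :=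
  [set A | `|a A| = `|b A|].

(* Twice the real part of [x * star y]. *)
Definition cross (x y : F) : F := `|x + y| ^+ 2 - `|x| ^+ 2 - `|y| ^+ 2.

Lemma crossE x y : cross x y = x * star y + y * star x.
Proof. by rewrite /cross -!starE rmorphD; ring. Qed.

Lemma continuous_cross a b : continuous a -> continuous b ->
  continuous (fun A => cross (a A) (b A)).
Proof.
move=> ca cb; rewrite /cross; have sq (f : 'M[F]_n -> F) : continuous f ->
    continuous (fun A => `|f A| ^+ 2).
  by move=> cf; apply: continuous_mul; exact: continuous_normr.
by do 2?apply: continuous_sub; apply: sq => //; exact: continuous_add.
Qed.

Lemma tie_measurable a b : continuous a -> continuous b -> measurable (tie a b).
Proof.
move=> ca cb; rewrite (_ : tie a b = [set A | `|a A| - `|b A| = 0]).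
  by apply: measurable_eq0; apply: continuous_sub; exact: continuous_normr.
apply/seteqP; split=> A; rewrite /tie /= => /eqP; first by rewrite -subr_eq0 => /eqP.
by rewrite subr_eq0 => /eqP.
Qed.

(* A real rotation does not break a tie with vanishing [cross]; this can only
   happen over the complex numbers, where the matrices
   [[cos, i sin], [i sin, cos]] preserve [cross] and break the tie. *)
Definition generic_tie a b : set (borel_mx F n) :=
  tie a b `&` [set A | cross (a A) (b A) != 0].
Definition special_tie a b : set (borel_mx F n) :=
  tie a b `&` [set A | cross (a A) (b A) = 0] `&` [set A | a A != 0].

Lemma generic_tie_measurable a b : continuous a -> continuous b ->
  measurable (generic_tie a b).
Proof.
move=> ca cb; apply: measurableI; first exact: tie_measurable.
by apply: measurable_neq0; exact: continuous_cross.
Qed.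

Lemma special_tie_measurable a b : continuous a -> continuous b ->
  measurable (special_tie a b).
Proof.
move=> ca cb; apply: measurableI; last exact: measurable_neq0.
apply: measurableI; first exact: tie_measurable.
by apply: measurable_eq0; exact: continuous_cross.
Qed.

Variables (a b : 'M[F]_n -> F).
Hypotheses (ca : continuous a) (cb : continuous b).
Hypothesis lift : forall x y z t, unitary2 star x y z t ->
  exists2 g, G g & forall A,
    a (g *m A) = x * a A + y * b A /\ b (g *m A) = z * a A + t * b A.

Lemma continuous_comb x y : continuous (fun A => x * a A + y * b A).
Proof.
have cst (c : F) : continuous (fun _ : 'M[F]_n => c) by move=> ?; exact: cst_continuous.
by apply: continuous_add; apply: continuous_mul.
Qed.

(** By [lift], mixing [a] and [b] amounts to a translation by an element of the group. The event [E]
    is abstract in order to cover generic and special ties. *)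
Lemma tie_translate (E : ('M[F]_n -> F) -> ('M[F]_n -> F) -> set (borel_mx F n))
    x y z t : 
  (forall a b, continuous a -> continuous b -> measurable (E a b)) ->
  (forall a b (g : 'M[F]_n), (fun A : 'M[F]_n => g *m A) @^-1` E a b =
     E (fun A => a (g *m A)) (fun A => b (g *m A))) ->
  unitary2 star x y z t ->
  mu (E (fun A => x * a A + y * b A) (fun A => z * a A + t * b A)) = mu (E a b).
Proof.
move=> mE pE /lift[g Gg gE]; have [_ inv] := mu_haar.
rewrite -(inv g _ Gg (mE _ _ ca cb)) pE; congr (mu (E _ _)).
  by apply/funext => A; have [] := gE A.
by apply/funext => A; have [] := gE A.
Qed.

Lemma star_rot_cos l : star (rot_cos F l) = rot_cos F l.
Proof.
rewrite /rot_cos fmorph_div rmorphB rmorphD /= rmorphXn /=.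
by rewrite rmorph_nat rmorph1.
Qed.

Lemma star_rot_sin l : star (rot_sin F l) = rot_sin F l.
Proof.
rewrite /rot_sin fmorph_div rmorphD rmorphXn rmorphM /=.
by rewrite !rmorph_nat rmorph1.
Qed.

(** A matrix in two rotated copies satisfies two independent linear equations in the difference of
    squared moduli and in [cross]. Both vanish, and then so does [cross] of the rotated pair. *)
Lemma generic_tie_null : mu (generic_tie a b) = 0%E.
Proof.
pose c := rot_cos F; pose s := rot_sin F.
have sc k : star (c k) = c k by exact: star_rot_cos.
have ss k : star (s k) = s k by exact: star_rot_sin.
have cs l : c l ^+ 2 + s l ^+ 2 = 1 by exact: rot_cos2Dsin2.
have ind := @rot_independent F; rewrite -/c -/s in ind; clearbody c s.
have U l : unitary2 star (c l) (- s l) (s l) (c l).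
  have h := cs l.
  by split; rewrite ?rmorphN /= ?sc ?ss -?h; ring.
apply: (@null_of_disjoint_copies (fun l => generic_tie
  (fun A => c l * a A + - s l * b A) (fun A => s l * a A + c l * b A))).
- by move=> l; apply: generic_tie_measurable; exact: continuous_comb.
- move=> l m _ _ [A [[tl nl] [tm _]]].
  apply/eqP/negPn/negP => lm.
  have key k : `|c k * a A + - s k * b A| = `|s k * a A + c k * b A| ->
      (c k ^+ 2 - s k ^+ 2) * (`|a A| ^+ 2 - `|b A| ^+ 2) =
      2 * c k * s k * cross (a A) (b A).
    move=> /(congr1 (fun x => x ^+ 2)); rewrite -!starE crossE.
    rewrite !rmorphD /= !rmorphM /= rmorphN /= sc ss => e.
    apply/eqP; rewrite -subr_eq0; move/eqP: e; rewrite -subr_eq0 => /eqP e.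
    by apply/eqP; rewrite -[RHS]e; ring.
  have [D0 T0] := ind _ _ _ _ lm (key l tl) (key m tm).
  move/eqP: nl; apply; move: T0 D0; rewrite !crossE -!starE.
  rewrite !rmorphD /= !rmorphM /= rmorphN /= sc ss => T0 D0.
  (* Rotation by an angle acts on these two quantities as a rotation by the doubled angle. *)
  transitivity (2 * c l * s l * (a A * star (a A) - b A * star (b A)) +
    (c l ^+ 2 - s l ^+ 2) * (a A * star (b A) + b A * star (a A))); first ring.
  by rewrite D0 T0 !mulr0 addr0.
- move=> l; apply: (tie_translate generic_tie_measurable) => //; exact: U.
- exact: generic_tie_measurable.
Qed.

Lemma special_tie_null : mu (special_tie a b) = 0%E.
Proof.
case: star_id_or_i => [star_id|[i si ii]].
  (* In the real case [cross] is twice the product, so a tie with vanishing [cross] is a tie between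
     zeros. *)
  rewrite (_ : special_tie a b = set0) ?measure0 //.
  apply/seteqP; split=> // A [[tA cA] /eqP aA]; apply: aA.
  move: cA; rewrite /= crossE !star_id [b A * a A]mulrC -mulr2n => /eqP.
  rewrite mulrn_eq0 mulf_eq0 /= => /orP[/eqP //|/eqP b0].
  by apply/eqP; rewrite -normr_eq0 tA b0 normr0.
pose c := rot_cos F; pose s := rot_sin F.
have sc k : star (c k) = c k by exact: star_rot_cos.
have ss k : star (s k) = s k by exact: star_rot_sin.
have cs l : c l ^+ 2 + s l ^+ 2 = 1 by exact: rot_cos2Dsin2.
have ind := @rot_independent F; rewrite -/c -/s in ind; clearbody c s.
have U l : unitary2 star (c l) (i * s l) (i * s l) (c l).
  have h := cs l.
  have e x : i * x * (- i * x) = x ^+ 2.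
    by transitivity (- (i * i) * x ^+ 2); [ring | rewrite ii; ring].
  by split; rewrite ?rmorphM /= ?sc ?ss ?si ?e -?h; ring.
apply: (@null_of_disjoint_copies (fun l => special_tie
  (fun A => c l * a A + i * s l * b A) (fun A => i * s l * a A + c l * b A))).
- by move=> l; apply: special_tie_measurable; exact: continuous_comb.
- move=> l m _ _ [A [[[tl cl] nl] [[tm _] _]]].
  apply/eqP/negPn/negP => lm.
  (* Twice the imaginary part of [a A * star (b A)]; it takes over the role of [cross] in the linear
     system. *)
  pose W := i * (b A * star (a A) - a A * star (b A)).
  have key k : `|c k * a A + i * s k * b A| = `|i * s k * a A + c k * b A| ->
      (c k ^+ 2 - s k ^+ 2) * (`|a A| ^+ 2 - `|b A| ^+ 2) =
      2 * c k * s k * (- W).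
    move=> /(congr1 (fun x => x ^+ 2)); rewrite -!starE.
    rewrite !rmorphD /= !rmorphM /= sc ss si => e.
    apply/eqP; rewrite -subr_eq0; move/eqP: e; rewrite -subr_eq0 => /eqP e.
    apply/eqP; rewrite -[RHS]e /W.
    (* The relation for [i] enters a polynomial identity through multiples of [r]. *)
    pose r := i * i + 1; have r0 : r = 0 by rewrite /r ii addNr.
    transitivity ((c k ^+ 2 - s k ^+ 2) * (a A * star (a A) - b A * star (b A)) +
      2 * c k * s k * W + s k ^+ 2 * r * (a A * star (a A) - b A * star (b A))).
      by rewrite r0 /W; ring.
    by rewrite /W /r; ring.
  have [D0 W0] := ind _ _ _ _ lm (key l tl) (key m tm).
  (* These mixings preserve [cross], so it vanishes already for the original pair. *)
  have T0 : a A * star (b A) + b A * star (a A) = 0.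
    rewrite -[RHS]cl /= crossE !rmorphD /= !rmorphM /= sc ss si.
    pose r := i * i + 1; have r0 : r = 0 by rewrite /r ii addNr.
    have h := cs l.
    transitivity ((c l ^+ 2 + s l ^+ 2) * (a A * star (b A) + b A * star (a A))
       - s l ^+ 2 * r * (a A * star (b A) + b A * star (a A))).
      by rewrite h r0; ring.
    by rewrite /r; ring.
  have i0 : i != 0.
    by apply/eqP => i0; move/eqP: ii; rewrite i0 mul0r eq_sym oppr_eq0 oner_eq0.
  have ab : a A * star (b A) = 0.
    have : b A * star (a A) - a A * star (b A) = 0.
      by apply: (mulfI i0); rewrite mulr0 -/W; apply/eqP; rewrite -oppr_eq0 W0.
    move=> /eqP; rewrite subr_eq0 => /eqP e; move/eqP: T0; rewrite e -mulr2n.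
    by rewrite mulrn_eq0 => /eqP.
  have nab : `|a A| = `|b A|.
    apply/eqP; rewrite -(@eqrXn2 _ 2) //; by rewrite -subr_eq0 D0.
  have a0 : a A = 0.
    apply/eqP; move/eqP: ab; rewrite mulf_eq0 => /orP[//|].
    by rewrite -normr_eq0 (normr_star starE) -nab normr_eq0.
  have b0 : b A = 0 by apply/eqP; rewrite -normr_eq0 -nab a0 normr0.
  by move/eqP: nl; apply; rewrite a0 b0 !mulr0 addr0.
- move=> l; apply: (tie_translate special_tie_measurable) => //; exact: U.
- exact: special_tie_measurable.
Qed.

Lemma tie_null : mu.-negligible [set A | `|a A| = `|b A| /\ a A != 0].
Proof.
apply: (@negligibleS _ _ _ _ (generic_tie a b `|` special_tie a b)).
  move=> A [tA aA]; have [c0|c0] := eqVneq (cross (a A) (b A)) 0; [right|left] => //.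
apply: negligibleU; apply/negligibleP.
- exact: generic_tie_measurable.
- exact: generic_tie_null.
- exact: special_tie_measurable.
- exact: special_tie_null.
Qed.

End Ties.

End Haar.

(** * Counting pivot sequences *)

Section Counting.
Variable n : nat.

Definition pivot_seqs : {set {ffun 'I_n -> 'I_n}} :=
  [set p : {ffun 'I_n -> 'I_n} | [forall k : 'I_n, (k <= p k)%N]]%SET.

(** The last index counts as well; on valid sequences with [0 < n] it is always fixed, so the values
    start at 1 like those of a Stirling variable. *)
Definition fixed_steps (p : {ffun 'I_n -> 'I_n}) : nat :=
  #|[set k | p k == k]%SET|.

Lemma pivot_seqsP (p : {ffun 'I_n -> 'I_n}) : reflect (valid p) (p \in pivot_seqs).
Proof. by rewrite inE; exact: forallP. Qed.

Lemma in_pivot_seqs p :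
  (p \in pivot_seqs) = (p \in family (fun k : 'I_n => [pred i : 'I_n | (k <= i)%N])).
Proof. by apply/pivot_seqsP/familyP. Qed.

Lemma card_ord_ge m : (m <= n)%N -> #|[pred i : 'I_n | (m <= i)%N]| = (n - m)%N.
Proof.
move=> mn; rewrite -[X in (X - m)%N]card_ord -(cardC [pred i : 'I_n | (i < m)%N]).
have -> : #|[pred i : 'I_n | (i < m)%N]| = m.
  by rewrite -sum1_card -(big_ord_widen n (fun=> 1%N) mn) sum1_card card_ord.
by rewrite addKn; apply: eq_card => i; rewrite !inE -leqNgt.
Qed.

Lemma prod_fixed_steps :
  (\prod_(i < n) ('X + (i : nat)%:P) : {poly nat}) =
  \sum_(p in pivot_seqs) 'X^(fixed_steps p).
Proof.
pose f (k i : 'I_n) : {poly nat} := if i == k then 'X else 1.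
have -> : (\prod_(i < n) ('X + (i : nat)%:P) : {poly nat}) =
          \prod_(k < n) \sum_(i : 'I_n | (k <= i)%N) f k i.
  (* After reversal the constant of factor [k] is n - 1 - k, the number of choices [i > k]; the
     choice [i = k] carries the weight ['X]. *)
  rewrite (reindex_inj rev_ord_inj) /=; apply: eq_bigr => k _.
  rewrite (bigD1 k) //= {1}/f eqxx; congr (_ + _).
  rewrite (eq_bigr (fun=> 1)) => [|i /andP[_ ik]]; last by rewrite /f (negPf ik).
  rewrite (eq_bigl [pred i : 'I_n | (k < i)%N]) => [|i]; last first.
    by rewrite /= ltn_neqAle eq_sym andbC val_eqE.
  by rewrite sumr_const card_ord_ge // -polyC1 -polyCMn natn.
rewrite bigA_distr_big_dep; apply: eq_big => [p|p _]; first by rewrite in_pivot_seqs.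
rewrite /f -big_mkcond /= prodr_const; congr ('X^ _).
by apply: eq_card => k; rewrite !inE.
Qed.

Lemma stirling1E k :
  stirling1 n k = #|[set p in pivot_seqs | fixed_steps p == k]%SET|.
Proof.
rewrite /stirling1 prod_fixed_steps coef_sum -sum1_card.
rewrite [RHS](eq_bigl (fun p => (p \in pivot_seqs) && (fixed_steps p == k))) => [|p].
  rewrite [RHS]big_mkcondr; apply: eq_bigr => p _; rewrite coefXn eq_sym.
  by case: eqP.
by rewrite !inE.
Qed.

Lemma card_pivot_seqs : #|pivot_seqs| = n`!.
Proof.
have -> : n`! = (\prod_(k < n) \sum_(i : 'I_n | (k <= i)%N) 1)%N.
  rewrite -ffactnn ffact_prod; apply: eq_bigr => k _.
  by rewrite sum1_card card_ord_ge // ltnW.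
rewrite bigA_distr_big_dep -sum1_card; apply: eq_big => [p|p _].
  by rewrite in_pivot_seqs.
by rewrite big1_eq.
Qed.

Lemma fixed_steps_bounds p : (0 < n)%N -> p \in pivot_seqs ->
  (1 <= fixed_steps p <= n)%N.
Proof.
move=> n0 /pivot_seqsP vp; apply/andP; split; last first.
  by rewrite -[X in (_ <= X)%N](card_ord n); exact: max_card.
have ln : (n.-1 < n)%N by rewrite prednK.
apply/card_gt0P; exists (Ordinal ln); rewrite inE -val_eqE /=.
by have := vp (Ordinal ln); have := ltn_ord (p (Ordinal ln)) => /=; lia.
Qed.

(** For a valid sequence, a step that is not fixed has k < p k < n and hence is not the last one. *)
Lemma pivot_movementsE p : p \in pivot_seqs ->
  pivot_movements p = (n - fixed_steps p)%N.
Proof.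
move=> /pivot_seqsP vp; rewrite /pivot_movements cardsCs card_ord.
congr (n - _)%N; apply: eq_card => k; rewrite !inE -val_eqE /=.
have := vp k; have := ltn_ord (p k).
by move: (nat_of_ord k) (nat_of_ord (p k)) => a b; lia.
Qed.

Lemma pivot_movements_eq (p q : 'I_n -> 'I_n) :
  (forall k : 'I_n, (k.+1 < n)%N -> p k = q k) -> pivot_movements p = pivot_movements q.
Proof.
move=> pq; apply: eq_card => k; rewrite !inE.
by case: ltnP => //= kn; rewrite pq.
Qed.

End Counting.

(** * The law of the number of pivot movements *)

Lemma measure_fin_disjoint d (T : measurableType d) (R : realType)
    (mu : {measure set T -> \bar R}) (I : finType) (W : {set I}) (S : I -> set T) :
  (forall i, measurable (S i)) ->
  (forall i j x, i \in W -> j \in W -> S i x -> S j x -> i = j) ->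
  mu (\bigcup_(i in [set` W]) S i) = (\sum_(i in W) mu (S i))%E.
Proof.
move=> mS disj; rewrite measure_fin_bigcup //.
- have -> : [set` W] = [set` enum W] by apply/seteqP; split=> i /=; rewrite mem_enum.
  by rewrite -fsbig_seq ?enum_uniq // big_enum.
- by move=> i j Wi Wj [x [xi xj]]; exact: disj xj.
Qed.

Section StirlingLaw.
Variables (R : realType) (n : nat).

Lemma sum_stirling1 : (0 < n)%N ->
  \sum_(k < n.+1 | (0 < k)%N) ((stirling1 n k)%:R / n`!%:R : R) = 1.
Proof.
move=> n0; rewrite -mulr_suml -natr_sum.
have -> : (\sum_(k < n.+1 | (0 < k)%N) stirling1 n k = n`!)%N.
  rewrite -card_pivot_seqs -[RHS]sum1_card.
  rewrite (partition_big (fun p => inord (fixed_steps p) : 'I_n.+1)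
    (fun k => (0 < k)%N)) /=.
    apply: eq_bigr => k _; rewrite stirling1E -sum1_card; apply: eq_bigl => p.
    rewrite !inE; case: (boolP [forall k, _]) => //= vp.
    have /andP[_ pn] := fixed_steps_bounds n0 (introT (pivot_seqsP p) (forallP vp)).
    by rewrite -val_eqE /= inordK.
  move=> p vp; have /andP[p0 pn] := fixed_steps_bounds n0 vp.
  by rewrite inordK.
by rewrite divff // pnatr_eq0 -lt0n fact_gt0.
Qed.

(** The prescribed masses at 1, ..., n already add up to 1, so all other values together have
    probability zero. *)
Lemma stirling1_distributed_law d (U : measurableType d) (Q : probability U R)
    (Y : {RV Q >-> nat}) (B : set nat) : (0 < n)%N ->
  stirling1_distributed n Y ->
  Q (Y @^-1` B) = (\sum_(k < n.+1 | (0 < k)%N && ((k : nat) \in B))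
    ((stirling1 n k)%:R / n`!%:R)%:E)%E.
Proof.
move=> n0 hY.
have mY C : measurable (Y @^-1` C).
  by rewrite -[_ @^-1` _]setTI; exact: (measurable_funP Y).
pose S (C : set nat) := \bigcup_(k in [set`
  [set k : 'I_n.+1 | (0 < k)%N && ((k : nat) \in C)]%SET]) Y @^-1` [set (k : nat)].
have mS C : measurable (S C).
  by apply: fin_bigcup_measurable => //; exact: finite_finset.
have law C : Q (S C) = (\sum_(k < n.+1 | (0 < k)%N && ((k : nat) \in C))
    ((stirling1 n k)%:R / n`!%:R)%:E)%E.
  rewrite measure_fin_disjoint //.
    apply: eq_big => k; first by rewrite inE.
    by rewrite inE => /andP[k0 _]; apply: hY; rewrite k0 -ltnS ltn_ord.
  by move=> i j x _ _ /= -> ij; apply: val_inj.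
rewrite -law; apply/eqP; rewrite eq_le; apply/andP; split; last first.
  apply: le_measure; rewrite ?inE //.
  by move=> x [k]; rewrite /= !inE => /andP[_ kB] ->; exact: set_mem.
pose N := ~` S setT.
have N0 : Q N = 0%E.
  rewrite probability_setC // law sumEFin.
  rewrite (eq_bigl (fun k : 'I_n.+1 => (0 < k)%N)) => [|k].
    by rewrite sum_stirling1 // subee.
  by rewrite in_setT andbT.
rewrite -[leRHS]adde0 -N0; apply: le_trans (measureU2 _ _ _) => //; last first.
  exact: measurableC.
apply: le_measure; rewrite ?inE //.
  by apply: measurableU => //; exact: measurableC.
move=> x xB; have [xN|] := pselect (N x); first by right.
move=> /contrapT[k kT xk]; left; exists k => //; move: kT xB.
by rewrite /= !inE => /andP[-> _]; rewrite xk => /mem_set.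
Qed.

End StirlingLaw.

Lemma strict_set_disjoint (F : numFieldType) (n : nat)
    (p q : {ffun 'I_n -> 'I_n}) (A : 'M[F]_n) :
  p \in @pivot_seqs n -> q \in @pivot_seqs n ->
  strict_set p A -> strict_set q A -> p = q.
Proof.
move=> /pivot_seqsP vp /pivot_seqsP vq Sp Sq.
by apply/ffunP; exact: strict_set_inj Sp Sq.
Qed.

(** * Haar measure of the strict sets and the resulting law *)

Section GeppLaw.
Variables (R : realType) (F : numFieldType) (n : nat).
Variable star : {rmorphism F -> F}.
Hypothesis starE : forall x, x * star x = `|x| ^+ 2.
Hypothesis star_id_or_i :
  (forall x, star x = x) \/ exists2 i : F, star i = - i & i * i = -1.

Local Notation G := (@star_group F n star).

Variable piv : 'M[F]_n -> 'I_n -> 'I_n.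
Hypothesis pivP : forall M : 'M[F]_n, gepp_pivots M (piv M).

Section Law.
Variable mu : probability (borel_mx F n) R.
Hypothesis mu_haar : is_haar G mu.

(** Mixing the active rows [i] and [j] at step [k] is induced by a group element acting on the
    original matrix. *)
Lemma tie_set_null (p : 'I_n -> 'I_n) (k i j : 'I_n) :
  valid p -> (k <= i)%N -> (k <= j)%N -> i != j ->
  mu.-negligible (@tie_set F n p k i j).
Proof.
move=> vp ki kj ij.
apply: (tie_null starE star_id_or_i mu_haar (a := fun A => ff_matrix p A k i k)
  (b := fun A => ff_matrix p A k j k)); try exact: ff_matrix_continuous.
move=> x y z t U.
have [g Gg gE] := @ff_matrix_lift F n G p k (mix_mx i j x y z t)
  (@star_groupM F n star) (fun k i => @star_group_perm F n star (tperm k i))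
  vp (ltnW (ltn_ord k)) (mix_mx_star_group ij U) (mix_mx_block _ _ _ _ ki kj).
exists g => // A; rewrite gE !mix_mxM !eqxx.
by rewrite eq_sym (negPf ij).
Qed.

Definition strict_cover : set (borel_mx F n) :=
  \bigcup_(p in [set` @pivot_seqs n]) strict_set (p : 'I_n -> 'I_n).

Lemma strict_cover_measurable : measurable strict_cover.
Proof.
apply: fin_bigcup_measurable => [|p _]; first exact: finite_finset.
exact: strict_set_measurable.
Qed.

Lemma strict_cover_full : mu strict_cover = 1%E.
Proof.
have FF : Filter (nbhs (almost_everywhere mu)) by exact: ae_filter_ringOfSetsType.
have aeG : {ae mu, forall A, G A}.
  apply/negligibleP; first by apply: measurableC; exact: star_group_measurable.
  have [G1 _] := mu_haar; transitivity (1 - mu G)%E; last by rewrite G1 subee.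
  by apply: probability_setC; exact: star_group_measurable.
(* The index type is finite, so all tie sets can be discarded at once. *)
have aeT : {ae mu, forall A, forall t : {ffun 'I_n -> 'I_n} * 'I_n * 'I_n * 'I_n,
    let: (p, k, i, j) := t in valid p -> (k <= i)%N -> (k <= j)%N -> i != j ->
    ~ tie_set p k i j A}.
  apply: filter_forall => -[[[p k] i] j] /=.
  have [[vp ki kj ij]|no] := pselect [/\ valid p, (k <= i)%N, (k <= j)%N & i != j].
    apply: negligibleS (tie_set_null vp ki kj ij) => A /= H.
    by apply: contrapT => nA; apply: H.
  by apply: aeW => A vp ki kj ij; case: no.
have : {ae mu, forall A, strict_cover A}.
  apply: filterS2 aeG aeT => A GA TA.
  (* The value of [piv A] at the last index is unconstrained and is reset to make the sequence
     valid. *)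
  pose p := [ffun k : 'I_n => if (k.+1 < n)%N then piv A k else k].
  have vp : valid p.
    by move=> k; rewrite ffunE; case: ltnP => // kn; have [] := pivP A kn.
  exists p; first exact/pivot_seqsP.
  apply: pivots_strict_set => //.
  - exact: star_group_unit GA.
  - by move=> k i j; exact: (TA (p, k, i, j)).
  - move=> k kn; rewrite ffunE kn.
    rewrite (@gepp_matrix_eq F n p (piv A)); first exact: pivP.
    by move=> l lk; rewrite ffunE (leq_ltn_trans lk (ltn_ord k)).
move=> /negligibleP-/(_ (measurableC strict_cover_measurable)) e.
have := probability_setC mu (measurableC strict_cover_measurable).
by rewrite setCK e sube0.
Qed.

Lemma measure_strict_set_eq (p q : 'I_n -> 'I_n) : valid p -> valid q ->
  mu (strict_set p) = mu (strict_set q).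
Proof.
move=> vp vq; have [t tE] := @strict_set_row_perm F n p q vp vq.
have [_ inv] := mu_haar.
rewrite -(inv (perm_mx t) _ (star_group_perm _ _) (@strict_set_measurable F n q)).
congr (mu _); by apply/seteqP; split=> A /=; rewrite -row_permE => /tE.
Qed.

Lemma measure_strict_union (W : {set {ffun 'I_n -> 'I_n}}) :
  W \subset @pivot_seqs n ->
  mu (\bigcup_(p in [set` W]) strict_set (p : 'I_n -> 'I_n)) =
  (#|W|%:R / n`!%:R)%:E.
Proof.
move=> /fintype.subsetP WV.
have mS (p : {ffun 'I_n -> 'I_n}) := @strict_set_measurable F n p.
pose id0 : {ffun 'I_n -> 'I_n} := [ffun k => k].
have v0 : valid id0 by move=> k; rewrite ffunE.
pose r := fine (mu (strict_set id0)).
have rE (p : {ffun 'I_n -> 'I_n}) : p \in @pivot_seqs n -> mu (strict_set p) = r%:E.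
  move=> /pivot_seqsP vp; rewrite (measure_strict_set_eq vp v0) /r fineK //.
  exact: fin_num_measure.
have union (W' : {set {ffun 'I_n -> 'I_n}}) : {subset W' <= @pivot_seqs n} ->
    mu (\bigcup_(p in [set` W']) strict_set (p : 'I_n -> 'I_n)) = (#|W'|%:R * r)%:E.
  move=> W'V; rewrite measure_fin_disjoint => [||p q A pW qW]; last 2 first.
  - exact: mS.
  - by apply: strict_set_disjoint; exact: W'V.
  rewrite (eq_bigr (fun=> r%:E)) => [|p pW]; last by apply: rE; exact: W'V.
  by rewrite sumEFin sumr_const mulr_natl.
have r1 : n`!%:R * r = 1.
  have := union (@pivot_seqs n) (fun _ => id); rewrite -/strict_cover.
  by rewrite strict_cover_full card_pivot_seqs => -[].
have n0 : n`!%:R != 0 :> R by rewrite pnatr_eq0 -lt0n fact_gt0.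
by rewrite union //; congr (_ * _)%:E; apply: (mulfI n0); rewrite r1 divff.
Qed.

End Law.

(** Since [piv] is an arbitrary selection, a measurable version is read off from the strict set that
    contains the matrix. *)
Lemma gepp_law (n_gt0 : (0 < n)%N)
    (d d' : measure_display) (T : measurableType d) (U : measurableType d')
    (P : probability T R) (Q : probability U R)
    (Y : {RV Q >-> nat}) (A : {RV P >-> borel_mx F n}) :
  stirling1_distributed n Y -> is_haar G (distribution P A) ->
  eq_in_distribution P Q
    (fun w => (pivot_movements (piv (A w)))%:R)
    (fun w => n%:R - (Y w)%:R).
Proof.
move=> hY hA.
have mA (S : set (borel_mx F n)) : measurable S -> measurable (A @^-1` S).
  by move=> mS; rewrite -[_ @^-1` _]setTI; exact: (measurable_funP A).
(* The default 0 lies outside 1, ..., n and marks the null event that no strict set contains the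
   matrix. *)
pose X w := oapp (@fixed_steps n) 0%N
  [pick p in @pivot_seqs n | `[< strict_set (p : 'I_n -> 'I_n) (A w) >]].
have Xin (p : {ffun 'I_n -> 'I_n}) w :
    p \in @pivot_seqs n -> strict_set p (A w) -> X w = fixed_steps p.
  move=> pV Sp; rewrite /X; case: pickP => [q /andP[qV /asboolP Sq]|/(_ p)] /=.
    by rewrite (strict_set_disjoint qV pV Sq Sp).
  by rewrite pV; move/asboolP: Sp => ->.
have Xout w : ~ strict_cover (A w) -> X w = 0%N.
  move=> nc; rewrite /X; case: pickP => // q /andP[qV /asboolP Sq].
  by case: nc; exists q.
pose W (B : set nat) := [set p in @pivot_seqs n | fixed_steps p \in B]%SET.
pose SW B := \bigcup_(p in [set` W B]) @strict_set F n (p : {ffun 'I_n -> 'I_n}).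
have mSW B : measurable (SW B : set (borel_mx F n)).
  apply: fin_bigcup_measurable => [|p _]; first exact: finite_finset.
  exact: strict_set_measurable.
have Xpre B : ~ B 0%N -> X @^-1` B = A @^-1` SW B.
  move=> B0; apply/seteqP; split=> w /=.
    have [[p pV Sp]|nc] := pselect (strict_cover (A w)); last by rewrite Xout.
    rewrite (Xin p) // => fB; exists p => //=; rewrite inE.
    by apply/andP; split; [|exact: mem_set].
  by move=> [p /=]; rewrite inE => /andP[pV /set_mem fB] Sp; rewrite (Xin p).
clearbody X; have mX : measurable_fun setT X.
  (* If [B] contains the default value, its complement does not, and [Xpre] applies to the
     complement. *)
  move=> _ B _; rewrite setTI; have [B0|B0] := pselect (B 0%N); last first.
    by rewrite (Xpre B B0); exact: (mA _ (mSW B)).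
  have nB0 : ~ (~` B) 0%N by move=> /(_ B0).
  rewrite -[B]setCK -(preimage_setC X (~` B)) (Xpre _ nB0).
  exact: measurableC (mA _ (mSW _)).
pose Xrv : {RV P >-> nat} := HB.pack X (isMeasurableFun.Build _ _ _ _ X mX).
have hX : stirling1_distributed n Xrv.
  move=> k /andP[k0 _].
  have -> : Xrv @^-1` [set k] = A @^-1` SW [set k].
    by apply: Xpre => /= k00; move: k0; rewrite -k00.
  have WV : W [set k] \subset @pivot_seqs n.
    by apply/fintype.subsetP => p; rewrite inE => /andP[].
  have := measure_strict_union hA WV; rewrite stirling1E => e.
  transitivity (distribution P A (SW [set k])) => //; rewrite e.
  congr ((_%:R / _)%:E); apply: eq_card => p; rewrite !inE.
  by congr (_ && _); apply/idP/eqP => [/set_mem|e']; rewrite ?inE.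
(* Both sides are images under [f] of variables with the same Stirling law. *)
pose f (k : nat) : R := n%:R - k%:R.
have mf e (V : measurableType e) (V' : probability V R) (Z : {RV V' >-> nat}) :
    measurable_fun setT (fun w => f (Z w)).
  by move=> _ B _; have := measurable_funP Z measurableT (f @^-1` B) I.
pose X' : {RV P >-> R} := HB.pack (fun w => f (Xrv w))
  (isMeasurableFun.Build _ _ _ _ _ (mf _ _ _ Xrv)).
pose Y' : {RV Q >-> R} := HB.pack (fun w => f (Y w))
  (isMeasurableFun.Build _ _ _ _ _ (mf _ _ _ Y)).
exists X', Y'; split.
- have mC := mA _ strict_cover_measurable.
  have PC : P (~` (A @^-1` strict_cover)) = 0%E.
    transitivity (1 - distribution P A strict_cover)%E; first exact: probability_setC.
    by rewrite strict_cover_full // subee.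
  exists (~` (A @^-1` strict_cover)); split => //; first exact: measurableC.
  move=> w /=; apply: contra_not => -[p pV Sp].
  rewrite /X' /= /f (Xin p) //.
  have vp := pivot_seqsP p pV.
  rewrite (@pivot_movements_eq n (piv (A w)) p); last first.
    exact: (strict_set_pivots_unique vp Sp (pivP (A w))).
  rewrite pivot_movementsE // natrB //.
  by have /andP[] := fixed_steps_bounds n_gt0 pV.
- exact: aeW.
- move=> B mB; transitivity (P (Xrv @^-1` (f @^-1` B))) => //.
  transitivity (Q (Y @^-1` (f @^-1` B))) => //.
  rewrite (stirling1_distributed_law _ n_gt0 hX).
  by rewrite (stirling1_distributed_law _ n_gt0 hY).
Qed.

End GeppLaw.

(** * Specialization to the identity and to complex conjugation *)

Theorem corollary2 (R : realType) (n : nat) (n_gt0 : (0 < n)%N)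
    (d d' : measure_display) (T : measurableType d) (U : measurableType d')
    (P : probability T R) (Q : probability U R)
    (Y : {RV Q >-> nat}) (hY : stirling1_distributed n Y) :
  (forall (A : {RV P >-> borel_mx R n}) (piv : 'M[R]_n -> 'I_n -> 'I_n),
     is_haar (@orthogonal_group R n) (distribution P A) ->
     (forall M : 'M[R]_n, gepp_pivots M (piv M)) ->
     eq_in_distribution P Q
       (fun w => (pivot_movements (piv (A w)))%:R)
       (fun w => n%:R - (Y w)%:R)) /\
  (forall (A : {RV P >-> borel_mx R[i] n})
      (piv : 'M[R[i]]_n -> 'I_n -> 'I_n),
     is_haar (@unitary_group R n) (distribution P A) ->
     (forall M : 'M[R[i]]_n, gepp_pivots M (piv M)) ->
     eq_in_distribution P Q
       (fun w => (pivot_movements (piv (A w)))%:R)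
       (fun w => n%:R - (Y w)%:R)).
Proof.
split=> A piv hA hpiv.
- have starE (x : R) : x * idfun x = `|x| ^+ 2.
    by rewrite /= real_normK ?num_real // expr2.
  have GE : @star_group R n idfun = @orthogonal_group R n.
    apply/seteqP; split=> g; rewrite /star_group /orthogonal_group /= map_mx_id //.
  apply: (gepp_law starE _ hpiv n_gt0 hY); first by left.
  by rewrite GE.
- have starE (x : R[i]) : x * Num.conj x = `|x| ^+ 2 by rewrite normCK.
  have star_i : exists2 i : R[i], Num.conj i = - i & i * i = -1.
    by exists 'i; [exact: conjCi | rewrite -expr2 sqrCi].
  have GE : @star_group R[i] n Num.conj = @unitary_group R n.
    apply/seteqP; split=> g; rewrite /star_group /unitary_group /=.
      by move=> gU; apply/unitarymxP; rewrite -map_trmx.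
    by move/unitarymxP; rewrite -map_trmx.
  apply: (gepp_law starE (or_intror star_i) hpiv n_gt0 hY).
  by rewrite GE.
Qed.
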